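(* Consider the coordinated system with noisy observation of the mean-field described in the context. There is no loss of optimality in restricting attention to Markovian coordination strategies, i.e. strategies of the form $\Gamma_t=\psi_t(\Pi_t)$, $t=1,\dots,T$: the infimum of $\hat J(\boldsymbol\psi)$ over all coordination strategies $\Gamma_t=\psi_t(Y_{1:t})$ equals its infimum over Markovian ones. Also, an optimal strategy is obtained by solving the following dynamic program. Let $\Delta(\mathcal M_n)$ be the space of probability distributions on $\mathcal M_n$. Define $V_{T+1}(\pi):=0$ for all $\pi\in\Delta(\mathcal M_n)$ and, recursively for $t=T,\dots,1$ and $\pi_t\in\Delta(\mathcal M_n)$, $$V_t(\pi_t)=\min_{\gamma_t}\Big(\tilde\ell_t(\pi_t,\gamma_t)+\mathbb E[V_{t+1}(\Pi_{t+1})\mid \Pi_t=\pi_t,\Gamma_t=\gamma_t]\Big),$$ where the minimum is over all functions $\gamma_t:\mathcal X\to\mathcal U$. Let $\psi^*_t(\pi_t)$ denote any minimizer of the right-hand side. Then the coordination strategy $\boldsymbol\psi^*=(\psi^*_1,\dots,\psi^*_T)$, used as $\Gamma_t=\psi^*_t(\Pi_t)$, is optimal: $\hat J(\boldsymbol\psi^* )\le\hat J(\boldsymbol\psi)$ for every coordination strategy $\boldsymbol\psi$.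
   Context: Model. $n,T\in\mathbb N$; $\mathcal X$ (states) and $\mathcal U$ (actions) are finite sets. Subsystem $i\in\{1,\dots,n\}$ has state $X^i_t\in\mathcal X$ and action $U^i_t\in\mathcal U$ at time $t$; $\mathbf X_t=(X^1_t,\dots,X^n_t)$. The mean-field is $Z_t=\frac1n\sum_{i=1}^n\delta_{X^i_t}$, i.e. $Z_t(x)=\frac1n\sum_{i}\mathbb 1(X^i_t=x)$, taking values in the set $\mathcal M_n$ of probability distributions on $\mathcal X$ whose values all lie in $\{0,\frac1n,\dots,\frac nn\}$. Dynamics: $X^i_{t+1}=f_t(X^i_t,U^i_t,W^i_t,Z_t)$ for $t=1,\dots,T$, with given functions $f_t$ not depending on $i$. Observation: $Y_t=h_t(Z_t,N_t)\in\mathcal Y$ for $t=1,\dots,T$, with given functions $h_t$ and noises $N_t$ in a finite set $\mathcal N$ with PMF $P_{N_t}$. The initial states $X^i_1$ have common PMF $P_X$, the noises $W^i_t$ are discrete with PMF $P_{W_t}$ (not depending on $i$), and all of $X^1_1,\dots,X^n_1$, $W^i_t$, $N_t$ ($1\le i\le n$, $1\le t\le T$) are mutually independent. Costs: arbitrary functions $\ell_t:\mathcal X^n\times\mathcal U^n\to\mathbb R$. Coordinated system. A coordinator observes $Y_{1:t}=(Y_1,\dots,Y_t)$ and chooses a map $\Gamma_t:\mathcal X\to\mathcal U$ by $\Gamma_t=\psi_t(Y_{1:t})$; then $U^i_t=\Gamma_t(X^i_t)$ for all $i$. The collection $\boldsymbol\psi=(\psi_1,\dots,\psi_T)$ is a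 coordination strategy. Write $\ell_t(\mathbf x,\gamma):=\ell_t(\mathbf x,(\gamma(x^1),\dots,\gamma(x^n)))$ and $\hat J(\boldsymbol\psi)=\mathbb E^{\boldsymbol\psi}[\sum_{t=1}^T\ell_t(\mathbf X_t,\Gamma_t)]$. Optimal means minimizing $\hat J$ over all coordination strategies. Define $\Pi_t(z):=\mathbb P(Z_t=z\mid Y_{1:t},\Gamma_{1:t-1})$, $z\in\mathcal M_n$, so $\Pi_t\in\Delta(\mathcal M_n)$. A Markovian strategy $\Gamma_t=\psi_t(\Pi_t)$ is a coordination strategy because $\Pi_t$ is computed from $Y_{1:t}$ and the past choices $\Gamma_{1:t-1}$. Notation in the dynamic program. For $z\in\mathcal M_n$ let $H(z)=\{\mathbf x\in\mathcal X^n:\frac1n\sum_i\delta_{x^i}=z\}$ and $\hat\ell_t(z,\gamma)=\frac1{|H(z)|}\sum_{\mathbf x\in H(z)}\ell_t(\mathbf x,\gamma)$. Then $\tilde\ell_t(\pi,\gamma):=\sum_{z\in\mathcal M_n}\hat\ell_t(z,\gamma)\pi(z)$, which satisfies $\mathbb E[\ell_t(\mathbf X_t,\Gamma_t)\mid Y_{1:t},\Gamma_{1:t}]=\tilde\ell_t(\Pi_t,\Gamma_t)$. Let $p_t(\cdot\mid z,\gamma)$ be the law of $\frac1n\sum_i\delta_{f_t(x^i,\gamma(x^i),W^i_t,z)}$ with $\mathbf x$ uniform on $H(z)$ and independent of $(W^1_t,\dots,W^n_t)$; put $p_t(z'\mid\pi,\gamma)=\sum_z p_t(z'\mid z,\gamma)\pi(z)$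 and, for $t<T$, $r_{t+1}(y\mid z')=\mathbb P(h_{t+1}(z',N_{t+1})=y)$. Given $\Pi_t=\pi,\Gamma_t=\gamma$ (for any $\pi,\gamma$), $Y_{t+1}=y$ has probability $q_t(y\mid\pi,\gamma)=\sum_{z'}r_{t+1}(y\mid z')p_t(z'\mid\pi,\gamma)$, and on $Y_{t+1}=y$ with $q_t(y\mid\pi,\gamma)>0$ one has $\Pi_{t+1}(z')=r_{t+1}(y\mid z')p_t(z'\mid\pi,\gamma)/q_t(y\mid\pi,\gamma)$; this defines the conditional expectation in the recursion for $t<T$ (for $t=T$ it is $0$). *)

(* Defs.v *)
(* MathComp / MathComp-Analysis. *)
From HB Require Import structures.
From mathcomp Require Import all_boot all_order all_algebra.
From mathcomp Require Import all_classical all_reals all_analysis.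

Set Implicit Arguments.
Unset Strict Implicit.
Unset Printing Implicit Defensive.

Import Order.TTheory GRing.Theory Num.Theory.

Local Open Scope classical_set_scope.
Local Open Scope ring_scope.

(* An empirical distribution is encoded by its counts: z : meanfield n X is the
   distribution giving x the mass z(x)/n (see [mf_mass]), so that meanfield n X
   is in bijection with the set of distributions on X with values in
   {0, 1/n, ..., n/n} as soon as n > 0. *)
Definition meanfield (n : nat) (X : finType) : finType :=
  {z : {ffun X -> 'I_n.+1} | (\sum_x z x == n)%N}.

Definition mf_mass (R : realType) n (X : finType) (z : meanfield n X) (x : X) : R :=
  (val z x)%:R / n%:R.

Definition emp_counts n (X : finType) (x : {ffun 'I_n -> X}) : {ffun X -> 'I_n.+1} :=
  [ffun a => inord #|[pred i | x i == a]|].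

Lemma emp_countsE n (X : finType) (x : {ffun 'I_n -> X}) (a : X) :
  emp_counts x a = #|[pred i | x i == a]| :> nat.
Proof. by rewrite ffunE inordK // ltnS -[leqRHS]card_ord max_card. Qed.

Lemma emp_counts_sum n (X : finType) (x : {ffun 'I_n -> X}) :
  (\sum_a emp_counts x a == n)%N.
Proof.
apply/eqP; under eq_bigr do rewrite emp_countsE -sum1_card.
by rewrite -[RHS]card_ord -sum1_card (partition_big x predT).
Qed.

Definition emp n (X : finType) (x : {ffun 'I_n -> X}) : meanfield n X :=
  exist _ (emp_counts x) (emp_counts_sum x).

Lemma mf_mass_emp (R : realType) n (X : finType) (x : {ffun 'I_n -> X}) (a : X) :
  mf_mass R (emp x) a = n%:R^-1 * \sum_i (x i == a)%:R.
Proof.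
rewrite /mf_mass /= emp_countsE mulrC -natr_sum -sum1_card big_mkcond /=.
by congr (_ * _%:R); apply: eq_bigr => i _; rewrite !inE; case: eqP.
Qed.

(* Times are numbered from 0: index t stands for time t + 1, and only the
   indices t < T matter, T being the horizon. *)
Record system (R : realType) (X U : finType) (W : countType) (N : finType)
    (Y : choiceType) (n : nat) := System {
  dyn  : nat -> X -> U -> W -> meanfield n X -> X ;
  obs  : nat -> meanfield n X -> N -> Y ;
  cost : nat -> {ffun 'I_n -> X} -> {ffun 'I_n -> U} -> R
}.

Record primitives (Omega : Type) (X : finType) (W : countType) (N : finType)
    (n : nat) := Primitives {
  init   : 'I_n -> Omega -> X ;
  wnoise : 'I_n -> nat -> Omega -> W ;
  onoise : nat -> Omega -> N
}.

Definition prob (R : realType) d (Omega : measurableType d)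
    (P : probability Omega R) (A : set Omega) : R := fine (P A).

Definition cond_prob (R : realType) d (Omega : measurableType d)
    (P : probability Omega R) (A B : set Omega) : R :=
  prob P (A `&` B) / prob P B.

(* [mu] is the PMF of [xi], a discrete random variable. *)
Definition has_pmf (R : realType) d (Omega : measurableType d)
    (P : probability Omega R) (V : countType) (xi : Omega -> V) (mu : V -> R) :=
  forall v, measurable (xi @^-1` [set v]) /\ P (xi @^-1` [set v]) = (mu v)%:E.

Definition mutually_independent (R : realType) d (Omega : measurableType d)
    (P : probability Omega R) (I : finType) (F : I -> set (set Omega)) :=
  forall (J : {set I}) (A : I -> set Omega), (forall i, i \in J -> F i (A i)) ->
    prob P (\bigcap_(i in [set` J]) A i) = \prod_(i in J) prob P (A i).

(* The events generated by a discrete random variable: its values being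
   countable, every subset of its codomain is allowed. *)
Definition generated_events (Omega V : Type) (xi : Omega -> V) : set (set Omega) :=
  preimage_set_system setT xi setT.

Definition primitive_events (Omega : Type) X W N n (T : nat)
    (e : primitives Omega X W N n)
    (k : 'I_n + 'I_n * 'I_T + 'I_T) : set (set Omega) :=
  match k with
  | inl (inl i) => generated_events (init e i)
  | inl (inr it) => generated_events (wnoise e it.1 it.2)
  | inr t => generated_events (onoise e t)
  end.

Definition primitive_assumptions (R : realType) d (Omega : measurableType d)
    (P : probability Omega R) X W N n (T : nat) (e : primitives Omega X W N n)
    (PX : X -> R) (PW : nat -> W -> R) (PN : nat -> N -> R) : Prop :=
  [/\ forall i, has_pmf P (init e i) PX,
      forall i t, (t < T)%N -> has_pmf P (wnoise e i t) (PW t),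
      forall t, (t < T)%N -> has_pmf P (onoise e t) (PN t)
    & mutually_independent P (primitive_events (T := T) e)].

(* The action profile generated by the prescription gamma. *)
Definition profile n (X U : finType) (gamma : {ffun X -> U})
    (x : {ffun 'I_n -> X}) : {ffun 'I_n -> U} := [ffun i => gamma (x i)].

Definition gcost R X U W N Y n (S : @system R X U W N Y n) (t : nat)
    (x : {ffun 'I_n -> X}) (gamma : {ffun X -> U}) : R :=
  cost S t x (profile gamma x).

Definition strategy (X U : finType) (Y : choiceType) : Type :=
  forall t : nat, t.+1.-tuple Y -> {ffun X -> U}.

(* Joint state and observation history at index t, under the strategy psi. *)
Fixpoint traj R X U W N Y n (S : @system R X U W N Y n) Omega
    (e : primitives Omega X W N n) (psi : strategy X U Y) (t : nat) (w : Omega) :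
    {ffun 'I_n -> X} * t.+1.-tuple Y :=
  match t with
  | 0 =>
    let x := [ffun i => init e i w] in
    (x, [tuple obs S 0 (emp x) (onoise e 0 w)])
  | s.+1 =>
    let: (x, y) := traj S e psi s w in
    let gamma := psi s y in
    let x' := [ffun i => dyn S s (x i) (gamma (x i)) (wnoise e i s w) (emp x)] in
    (x', [tuple of rcons y (obs S s.+1 (emp x') (onoise e s.+1 w))])
  end.

Definition state R X U W N Y n (S : @system R X U W N Y n) Omega
    (e : primitives Omega X W N n) (psi : strategy X U Y) t w :=
  (traj S e psi t w).1.

Definition history R X U W N Y n (S : @system R X U W N Y n) Omega
    (e : primitives Omega X W N n) (psi : strategy X U Y) t w :=
  (traj S e psi t w).2.

Definition prescription R X U W N Y n (S : @system R X U W N Y n) Omega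
    (e : primitives Omega X W N n) (psi : strategy X U Y) t w : {ffun X -> U} :=
  psi t (history S e psi t w).

Definition total_cost R X U W N Y n (S : @system R X U W N Y n) (T : nat)
    d (Omega : measurableType d) (P : probability Omega R)
    (e : primitives Omega X W N n) (psi : strategy X U Y) : \bar R :=
  ('E_P[fun w : Omega => (\sum_(t < T)
     gcost S t (state S e psi t w) (prescription S e psi t w) : R)%R])%E.

(* The atom containing w of the information Y_{1:t}, Gamma_{1:t-1}. *)
Definition info R X U W N Y n (S : @system R X U W N Y n) Omega
    (e : primitives Omega X W N n) (psi : strategy X U Y) t (w : Omega) :
    set Omega :=
  [set w' | history S e psi t w' = history S e psi t w /\
    forall s, (s < t)%N -> prescription S e psi s w' = prescription S e psi s w].

Definition belief R X U W N Y n (S : @system R X U W N Y n)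
    d (Omega : measurableType d) (P : probability Omega R)
    (e : primitives Omega X W N n) (psi : strategy X U Y) t (w : Omega) :
    {ffun meanfield n X -> R} :=
  [ffun z => cond_prob P [set w' | emp (state S e psi t w') = z]
                         (info S e psi t w)].

(* Belief-based laws are total functions on {ffun meanfield n X -> R}; only
   their values on the simplex [simplex] are relevant. *)
Definition simplex (R : realType) n X : set {ffun meanfield n X -> R} :=
  [set pi | (forall z, 0 <= pi z) /\ \sum_z pi z = 1].

Definition belief_law (R : realType) n (X U : finType) : Type :=
  nat -> {ffun meanfield n X -> R} -> {ffun X -> U}.

(* The strategy psi takes the form Gamma_t = phi_t(Pi_t), Pi_t being itself
   computed under psi.  The belief is defined only up to null events. *)
Definition implements R X U W N Y n (S : @system R X U W N Y n) (T : nat)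
    d (Omega : measurableType d) (P : probability Omega R)
    (e : primitives Omega X W N n) (phi : belief_law R n X U)
    (psi : strategy X U Y) : Prop :=
  forall t, (t < T)%N -> forall w, 0 < prob P (info S e psi t w) ->
    prescription S e psi t w = phi t (belief S P e psi t w).

Definition markovian R X U W N Y n (S : @system R X U W N Y n) (T : nat)
    d (Omega : measurableType d) (P : probability Omega R)
    (e : primitives Omega X W N n) : set (strategy X U Y) :=
  [set psi | exists phi, implements S T P e phi psi].

Definition fiber n (X : finType) (z : meanfield n X) : {set {ffun 'I_n -> X}} :=
  [set x | emp x == z]%SET.

Definition lhat R X U W N Y n (S : @system R X U W N Y n) t
    (z : meanfield n X) (gamma : {ffun X -> U}) : R :=
  #|fiber z|%:R^-1 * \sum_(x in fiber z) gcost S t x gamma.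

Definition ltilde R X U W N Y n (S : @system R X U W N Y n) t
    (pi : {ffun meanfield n X -> R}) (gamma : {ffun X -> U}) : R :=
  \sum_z lhat S t z gamma * pi z.

(* p_t(z' | z, gamma) *)
Definition trans R X U W N Y n (S : @system R X U W N Y n)
    d (Omega : measurableType d) (P : probability Omega R)
    (e : primitives Omega X W N n) t
    (z' z : meanfield n X) (gamma : {ffun X -> U}) : R :=
  #|fiber z|%:R^-1 * \sum_(x in fiber z)
    prob P [set w | emp [ffun i => dyn S t (x i) (gamma (x i)) (wnoise e i t w) z]
                    = z'].

(* p_t(z' | pi, gamma) *)
Definition predict R X U W N Y n (S : @system R X U W N Y n)
    d (Omega : measurableType d) (P : probability Omega R)
    (e : primitives Omega X W N n) t
    (z' : meanfield n X) (pi : {ffun meanfield n X -> R})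
    (gamma : {ffun X -> U}) : R :=
  \sum_z trans S P e t z' z gamma * pi z.

(* r_t(y | z) *)
Definition obs_prob R X U W N Y n (S : @system R X U W N Y n)
    d (Omega : measurableType d) (P : probability Omega R)
    (e : primitives Omega X W N n) t (y : Y) (z : meanfield n X) : R :=
  prob P [set w | obs S t z (onoise e t w) = y].

(* q_t(y | pi, gamma) *)
Definition next_obs_prob R X U W N Y n (S : @system R X U W N Y n)
    d (Omega : measurableType d) (P : probability Omega R)
    (e : primitives Omega X W N n) t (y : Y)
    (pi : {ffun meanfield n X -> R}) (gamma : {ffun X -> U}) : R :=
  \sum_z' obs_prob S P e t.+1 y z' * predict S P e t z' pi gamma.

Definition next_belief R X U W N Y n (S : @system R X U W N Y n)
    d (Omega : measurableType d) (P : probability Omega R)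
    (e : primitives Omega X W N n) t (y : Y)
    (pi : {ffun meanfield n X -> R}) (gamma : {ffun X -> U}) :
    {ffun meanfield n X -> R} :=
  [ffun z' => obs_prob S P e t.+1 y z' * predict S P e t z' pi gamma
              / next_obs_prob S P e t y pi gamma].

(* E[v(Pi_{t+1}) | Pi_t = pi, Gamma_t = gamma].  The sum over y has finite
   support, contained in the range of h_{t+1}; terms with q_t(y|pi,gamma) = 0
   vanish, whatever the value of [next_belief] there. *)
Definition cond_exp_next R X U W N Y n (S : @system R X U W N Y n)
    d (Omega : measurableType d) (P : probability Omega R)
    (e : primitives Omega X W N n) t
    (v : {ffun meanfield n X -> R} -> R)
    (pi : {ffun meanfield n X -> R}) (gamma : {ffun X -> U}) : R :=
  \sum_(y \in [set: Y])
    next_obs_prob S P e t y pi gamma * v (next_belief S P e t y pi gamma).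

Definition bellman_rhs R X U W N Y n (S : @system R X U W N Y n)
    d (Omega : measurableType d) (P : probability Omega R)
    (e : primitives Omega X W N n) t
    (v : {ffun meanfield n X -> R} -> R)
    (pi : {ffun meanfield n X -> R}) (gamma : {ffun X -> U}) : R :=
  ltilde S t pi gamma + cond_exp_next S P e t v pi gamma.

(* The minimum of g over all functions X -> U; the action u0 only provides the
   neutral starting value of the iterated minimum, itself a value of g. *)
Definition min_prescription (R : realType) (X U : finType) (u0 : U)
    (g : {ffun X -> U} -> R) : R :=
  \big[Num.min/g [ffun=> u0]]_(gamma : {ffun X -> U}) g gamma.

(* Value at index t with k stages to go. *)
Fixpoint value_to_go R X U W N Y n (S : @system R X U W N Y n)
    d (Omega : measurableType d) (P : probability Omega R)
    (e : primitives Omega X W N n) (u0 : U) (k t : nat)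
    (pi : {ffun meanfield n X -> R}) : R :=
  match k with
  | 0 => 0
  | j.+1 => min_prescription u0
              (bellman_rhs S P e t (value_to_go S P e u0 j t.+1) pi)
  end.

Definition value R X U W N Y n (S : @system R X U W N Y n) (T : nat)
    d (Omega : measurableType d) (P : probability Omega R)
    (e : primitives Omega X W N n) (u0 : U) (t : nat) :
    {ffun meanfield n X -> R} -> R :=
  value_to_go S P e u0 (T - t) t.

Lemma value_end R X U W N Y n (S : @system R X U W N Y n) (T : nat)
    d (Omega : measurableType d) (P : probability Omega R)
    (e : primitives Omega X W N n) (u0 : U) pi :
  value S T P e u0 T pi = 0.
Proof. by rewrite /value subnn. Qed.

Lemma value_rec R X U W N Y n (S : @system R X U W N Y n) (T : nat)
    d (Omega : measurableType d) (P : probability Omega R)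
    (e : primitives Omega X W N n) (u0 : U) t pi : (t < T)%N ->
  value S T P e u0 t pi =
  min_prescription u0 (bellman_rhs S P e t (value S T P e u0 t.+1) pi).
Proof. by move=> tT; rewrite /value -subnSK. Qed.

Definition dp_minimizer R X U W N Y n (S : @system R X U W N Y n) (T : nat)
    d (Omega : measurableType d) (P : probability Omega R)
    (e : primitives Omega X W N n) (u0 : U) (phi : belief_law R n X U) : Prop :=
  forall t, (t < T)%N -> forall pi, simplex pi ->
    bellman_rhs S P e t (value S T P e u0 t.+1) pi (phi t pi) =
    value S T P e u0 t pi.

(* Main.v *)
Require Import Defs.
From HB Require Import structures.
From mathcomp Require Import all_boot all_order all_algebra fingroup perm.
From mathcomp Require Import all_classical all_reals all_analysis.

Import Order.TTheory GRing.Theory Num.Theory.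
Local Open Scope classical_set_scope.
Local Open Scope ring_scope.
Set Implicit Arguments.
Unset Strict Implicit.
Unset Printing Implicit Defensive.

(** Why Markovian prescriptions suffice.

    Fix a coordination strategy psi.  At each stage the pair made of the joint
    state and the observation history is a function of primitive variables that
    are independent of the noises still to come ([traj_independent]).  Hence the
    joint law of state and history obeys a forward recursion, one factor per
    noise ([prob_trajS]).

    The subsystems are exchangeable: they have a common initial law, a common
    dynamics and common noise laws, the prescription is the same map for all of
    them, and they interact through the mean-field only.  So the joint law is
    invariant under permutations of the subsystems ([prob_traj_permute]).  Two
    joint states with the same mean-field differ by a permutation; the joint
    state is thus uniform on the fiber of the mean-field, given the mean-field
    and the history ([prob_traj_uniform]).  Summing the recursion over fibers
    leaves a recursion for the unnormalised belief
      joint psi ys z = P (Z_t = z, Y_{1:t} = ys),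
    in which psi enters through the single value psi_t(ys) ([jointS]).  This is
    a partially observed Markov decision process with state Z_t, and its
    expected stage costs are those of the averaged cost lhat
    ([expected_stage_cost]).

    The dynamic program is then verified on unnormalised beliefs.  If m is the
    mass of b, m times the Bellman right-hand side at b/m is a sum over the next
    observations of terms of the same shape, without any division
    ([scaled_bellmanE]).  Therefore the expected value-to-go
    E[V_t(Pi_t)] ([value_sum]) is at most E[cost_t] + E[V_{t+1}(Pi_{t+1})], with
    equality when the prescription minimises the right-hand side at every
    history of positive probability.  Telescoping bounds every total cost below
    by E[V_1(Pi_1)], which does not depend on psi as the first observation
    precedes all prescriptions, and strategies that implement a minimiser attain
    the bound.  Such strategies exist: the belief can be computed recursively
    from the observations by the Bayes filter ([filter_strategy_implements]). *)

(** * Random variables with finitely many or countably many values *)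

Section DiscreteVariables.
Context {R : realType} {d : measure_display} {Omega : measurableType d}.
Variable P : probability Omega R.

Lemma prob_ge0 A : 0 <= prob P A.
Proof. exact: fine_ge0. Qed.

Lemma probE A : measurable A -> (prob P A)%:E = P A.
Proof. by move=> mA; rewrite /prob fineK// fin_num_measure. Qed.

Lemma prob_setT : prob P setT = 1.
Proof. by rewrite /prob probability_setT. Qed.

Lemma prob_set0 : prob P set0 = 0.
Proof. by rewrite /prob measure0. Qed.

Lemma fibers_cover (V : finType) (f : Omega -> V) (A : set Omega) :
  A = \bigcup_v (A `&` [set w | f w = v]).
Proof. by apply/seteqP; split=> [w Aw|w [v _ []]//]; exists (f w). Qed.

Lemma measurable_finite_partition (V : finType) (f : Omega -> V) (A : set Omega) :
    (forall v, measurable (A `&` [set w | f w = v])) -> measurable A.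
Proof.
move=> mA; rewrite (fibers_cover f A); apply: fin_bigcup_measurable => //.
Qed.

Lemma prob_finite_partition (V : finType) (f : Omega -> V) (A : set Omega) :
    (forall v, measurable (A `&` [set w | f w = v])) ->
  prob P A = \sum_v prob P (A `&` [set w | f w = v]).
Proof.
move=> mA; have mA' := measurable_finite_partition mA.
apply/EFin_inj; rewrite probE// {1}(fibers_cover f A) measure_fin_bigcup//;
  last 2 first.
- exact: finite_finset.
- by move=> v v' _ _ [w [[_ <-] [_ <-]]].
rewrite (_ : setT = [set` index_enum V]); last first.
  by apply/seteqP; split=> // v _ /=; exact: mem_index_enum.
rewrite -fsbig_seq ?index_enum_uniq// -sumEFin.
by apply: eq_bigr => v _; rewrite probE.
Qed.

Lemma prob_finite_image (V : finType) (Z : eqType) (f : Omega -> V) (g : V -> Z)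
    (z : Z) (B : set Omega) :
    (forall v, measurable (B `&` [set w | f w = v])) ->
  measurable ([set w | g (f w) = z] `&` B) /\
  prob P ([set w | g (f w) = z] `&` B) =
    \sum_(v | g v == z) prob P (B `&` [set w | f w = v]).
Proof.
move=> mB; set E := _ `&` B.
have fE v : E `&` [set w | f w = v] =
    if g v == z then B `&` [set w | f w = v] else set0.
  case: eqP => gv.
    by apply/seteqP; split=> w /= [] => [[_ Bw] fw|Bw fw]; split=> //;
      split=> //=; rewrite fw.
  by apply/seteqP; split=> // w [[/= gw _] fw]; apply: gv; rewrite -fw.
have mE v : measurable (E `&` [set w | f w = v]).
  by rewrite fE; case: ifP => _; [exact: mB|exact: measurable0].
split; first exact: measurable_finite_partition mE.
rewrite (prob_finite_partition mE) [RHS]big_mkcond; apply: eq_bigr => v _.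
by rewrite fE; case: ifP => // _; exact: prob_set0.
Qed.

Lemma expectation_discrete (V : choiceType) (f : Omega -> V) (s : seq V)
    (g : V -> R) :
    uniq s -> (forall w, f w \in s) ->
    (forall v, v \in s -> measurable [set w | f w = v]) ->
  P.-integrable setT (fun w => (g (f w))%:E) /\
  (\int[P]_w (g (f w))%:E = (\sum_(v <- s) g v * prob P [set w | f w = v])%:E)%E.
Proof.
move=> us fs mf.
have mf' v : measurable [set w | f w = v].
  have [/mf//|vs] := boolP (v \in s).
  rewrite (_ : [set w | _] = set0)//; apply/seteqP; split=> // w /= wv.
  by move: vs; rewrite -wv fs.
have gE : (fun w => (g (f w))%:E) =
    (fun w => \sum_(v <- s) (g v)%:E * (\1_[set w | f w = v] w)%:E)%E.
  apply/funext => w; rewrite (bigD1_seq (f w))//= indicE.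
  rewrite mem_set// mule1 big1 ?adde0// => v /eqP vw.
  by rewrite indicE memNset ?mule0// => /= wv; apply: vw.
have ig v : P.-integrable setT
    (fun w => (g v)%:E * (\1_[set w | f w = v] w)%:E)%E.
  by apply: integrableZl => //; exact: integrable_indic.
split; rewrite gE; first exact: integrable_sum.
rewrite integral_sum// -sumEFin; apply: eq_bigr => v _.
rewrite integralZl//; last exact: integrable_indic.
by rewrite integral_indic// setIT EFinM probE.
Qed.

(* The values of a countable type are listed along nat by their codes, so that
   sigma-additivity applies to the fibers. *)
Let atom (V : countType) (xi : Omega -> V) (B : set V) (k : nat) : set Omega :=
  if pickle_inv k is Some v then if v \in B then xi @^-1` [set v] else set0
  else set0.

Let preimage_atoms (V : countType) (xi : Omega -> V) B :
  xi @^-1` B = \bigcup_k atom xi B k.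
Proof.
rewrite /atom; apply/seteqP; split=> [w Bw|w [k _]].
  by exists (pickle (xi w)) => //=; rewrite pickleK_inv mem_set.
by case: pickle_inv => //= v; case: ifPn => //; rewrite inE => + ->.
Qed.

Let measurable_atom (V : countType) (xi : Omega -> V) mu B k :
  has_pmf P xi mu -> measurable (atom xi B k).
Proof.
move=> h; rewrite /atom; case: pickle_inv => [v|]//; case: ifP => // _.
by have [] := h v.
Qed.

(** A PMF gives the measurability of points only; countability of the values
    extends it to all events. *)
Lemma measurable_pmf (V : countType) (xi : Omega -> V) (mu : V -> R) B :
  has_pmf P xi mu -> measurable (xi @^-1` B).
Proof.
move=> h; rewrite preimage_atoms; apply: bigcupT_measurable => k.
exact: measurable_atom h.
Qed.

(** This is how the assumption that initial states and process noises have laws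
    independent of the subsystem is used. *)
Lemma prob_pmf (V : countType) (xi xi' : Omega -> V) (mu : V -> R) B :
    has_pmf P xi mu -> has_pmf P xi' mu ->
  prob P (xi @^-1` B) = prob P (xi' @^-1` B).
Proof.
move=> h h'; congr fine.
suff series zeta : has_pmf P zeta mu -> P (zeta @^-1` B) = (\sum_(k <oo)
    if pickle_inv k is Some v then if v \in B then (mu v)%:E else 0 else 0)%E.
  by rewrite series// series.
move=> hz; rewrite preimage_atoms measure_semi_bigcup//.
- apply: eq_eseriesr => k _; rewrite /atom.
  case: pickle_inv => [v|]; last by rewrite measure0.
  by case: ifP => _; [have [] := hz v|rewrite measure0].
- by move=> k; exact: measurable_atom hz.
- move=> i j _ _ [w []]; rewrite /atom.
  have := pickle_invK (T := V) i; have := pickle_invK (T := V) j.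
  do 2 case: pickle_inv => [?|]//=; move=> <- <-.
  by do 2 case: ifP => //= _; move=> <- <-.
- by apply: bigcupT_measurable => k; exact: measurable_atom hz.
Qed.

End DiscreteVariables.

(** * Trajectories and observation histories *)

Section Model.
Context {R : realType} {d : measure_display} {Omega : measurableType d}.
Context {X U : finType} {W : countType} {N : finType} {Y : choiceType} {n : nat}.
Variables (P : probability Omega R) (S : system R X U W N Y n).
Variable e : primitives Omega X W N n.

Definition next_state t (x : {ffun 'I_n -> X}) (gamma : {ffun X -> U}) w :=
  [ffun i => dyn S t (x i) (gamma (x i)) (wnoise e i t w) (emp x)].

Definition next_state_prob t x gamma x' : R :=
  prob P [set w | next_state t x gamma w = x'].

Lemma trajS (psi : strategy X U Y) t x ys w : traj S e psi t w = (x, ys) ->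
  traj S e psi t.+1 w =
  (next_state t x (psi t ys) w,
   [tuple of rcons ys
     (obs S t.+1 (emp (next_state t x (psi t ys) w)) (onoise e t.+1 w))]).
Proof. by move=> /= ->. Qed.

(** One step of the dynamics seen backwards: for a prescribed current state x, a
    value of the trajectory at the next stage splits into a condition on the past
    and one condition on each noise of the step. *)
Lemma traj_stepP (psi : strategy X U Y) t x (ys : t.+1.-tuple Y) x' y w :
  (traj S e psi t.+1 w = (x', [tuple of rcons ys y]) /\ state S e psi t w = x) <->
  [/\ traj S e psi t w = (x, ys), next_state t x (psi t ys) w = x' &
    obs S t.+1 (emp x') (onoise e t.+1 w) = y].
Proof.
rewrite /state; case tw: (traj S e psi t w) => [x0 ys0].
rewrite (trajS tw); split=> [[[<-] /rcons_inj[/val_inj <- <-] /= <-]//|].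
by move=> [[-> ->] <- <-].
Qed.

Lemma historyS (psi : strategy X U Y) t w : history S e psi t.+1 w =
  [tuple of rcons (history S e psi t w)
     (obs S t.+1 (emp (state S e psi t.+1 w)) (onoise e t.+1 w))].
Proof. by rewrite /history /state /=; case: (traj _ _ _ _ _). Qed.

Lemma rcons_tuple_inj k (ys ys' : k.-tuple Y) y y' :
  [tuple of rcons ys y] = [tuple of rcons ys' y'] -> ys = ys' /\ y = y'.
Proof. by move=> /(congr1 val)/rcons_inj[/val_inj ? ?]. Qed.

Lemma tuple_rcons k (ys : k.+2.-tuple Y) :
  exists (ys' : k.+1.-tuple Y) y, ys = [tuple of rcons ys' y].
Proof.
case/tupleP: ys => y0 ys; exists [tuple of belast y0 ys], (last y0 ys).
by apply: val_inj; rewrite /= lastI.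
Qed.

Lemma history_prefix (psi : strategy X U Y) t s w w' : (s <= t)%N ->
    history S e psi t w' = history S e psi t w ->
  history S e psi s w' = history S e psi s w.
Proof.
elim: t => [|t IH]; first by rewrite leqn0 => /eqP->.
rewrite leq_eqVlt => /predU1P[->//|st].
by rewrite !historyS => /rcons_tuple_inj[/(IH st)].
Qed.

(** The past prescriptions being functions of the past observations, the
    observation history alone carries the common information. *)
Lemma infoE (psi : strategy X U Y) t w :
  info S e psi t w = [set w' | history S e psi t w' = history S e psi t w].
Proof.
apply/seteqP; split=> [w' []//|w' ww' /=]; split=> // s /ltnW st.
by rewrite /prescription (history_prefix st ww').
Qed.

(** The observation space may be infinite, but only finitely many observations
    can occur; sums over observations and histories range over these. *)
Definition obs_values t : seq Y :=
  undup [seq obs S t z nu | z <- enum (meanfield n X), nu <- enum N].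

Lemma obs_valuesP t z nu : obs S t z nu \in obs_values t.
Proof.
by rewrite mem_undup; apply/allpairsP; exists (z, nu); rewrite !mem_enum.
Qed.

Fixpoint histories t : seq (t.+1.-tuple Y) :=
  match t with
  | 0 => [seq [tuple y] | y <- obs_values 0]
  | s.+1 => [seq [tuple of rcons (ys : s.+1.-tuple Y) y]
              | ys <- histories s, y <- obs_values s.+1]
  end.

Lemma histories_uniq t : uniq (histories t).
Proof.
elim: t => [|t IH] /=.
  by rewrite map_inj_uniq ?undup_uniq// => y y' [].
apply: allpairs_uniq => //; first exact: undup_uniq.
by move=> [ys y] [ys' y'] _ _ /= /rcons_tuple_inj[-> ->].
Qed.

Lemma mem_histories psi t w : history S e psi t w \in histories t.
Proof.
elim: t => [|t IH]; first by apply: (map_f (fun y => [tuple y])); exact: obs_valuesP.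
by rewrite historyS; apply/allpairsP; eexists (_, _); split; last by [];
  [exact: IH | exact: obs_valuesP].
Qed.

(** * Independence of the trajectory from later noises *)

Section Independence.
Context {T : nat} {PX : X -> R} {PW : nat -> W -> R} {PN : nat -> N -> R}.
Hypothesis He : primitive_assumptions P T e PX PW PN.

Lemma measurable_init i B : measurable (init e i @^-1` B).
Proof. by have [h _ _ _] := He; exact: measurable_pmf (h i). Qed.

Lemma measurable_wnoise i t B : (t < T)%N -> measurable (wnoise e i t @^-1` B).
Proof. by have [_ h _ _] := He => tT; exact: measurable_pmf (h i t tT). Qed.

Lemma measurable_onoise t B : (t < T)%N -> measurable (onoise e t @^-1` B).
Proof. by have [_ _ h _] := He => tT; exact: measurable_pmf (h t tT). Qed.

Lemma prob_init_eq i j B :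
  prob P (init e i @^-1` B) = prob P (init e j @^-1` B).
Proof. by have [h _ _ _] := He; exact: prob_pmf (h i) (h j). Qed.

Lemma prob_wnoise_eq i j t B : (t < T)%N ->
  prob P (wnoise e i t @^-1` B) = prob P (wnoise e j t @^-1` B).
Proof. by have [_ h _ _] := He => tT; exact: prob_pmf (h i t tT) (h j t tT). Qed.

Lemma measurable_primitive_event k A :
  primitive_events (T := T) e k A -> measurable A.
Proof.
case: k => [[i|[i s]]|s] [B _ <-] /=; rewrite setTI.
- exact: measurable_init.
- exact: measurable_wnoise.
- exact: measurable_onoise.
Qed.

Notation source := ('I_n + 'I_n * 'I_T + 'I_T)%type.
Implicit Types A : source -> set Omega.

Definition primitive_family A := forall k, primitive_events e k (A k).

Lemma measurable_cylinder A : primitive_family A -> measurable (\bigcap_k A k).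
Proof.
move=> hA; apply: fin_bigcap_measurable => // k _.
exact: measurable_primitive_event (hA k).
Qed.

Lemma prob_cylinder A : primitive_family A ->
  prob P (\bigcap_k A k) = \prod_k prob P (A k).
Proof.
move=> hA; have [_ _ _ h] := He.
have := h [set: source]%SET A (fun k _ => hA k).
rewrite (_ : [set` _] = setT); last first.
  by apply/seteqP; split=> // k _ /=; rewrite finset.in_setT.
by move=> ->; apply: eq_bigl => k; rewrite finset.in_setT.
Qed.

(** The primitive variables on which the state and the history at index t do not
    depend.  The bounds differ because the observation noise of index t enters
    the history at index t, the process noises of index t only the next state. *)
Definition fresh t (k : source) : bool :=
  match k with
  | inl (inl _) => false
  | inl (inr it) => (t <= it.2)%N
  | inr s => (t < s)%N
  end.

(** The family A with its events at the noises of the step from t to t+1 replaced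
    by B and C.  It turns conditions on that step into a product event that is
    still fresh at index t, which drives the induction of [traj_independent]. *)
Definition slice t (B : 'I_n -> set W) (C : set N) A (k : source) : set Omega :=
  match k with
  | inl (inl _) => A k
  | inl (inr it) =>
      if it.2 == t :> nat then wnoise e it.1 it.2 @^-1` B it.1 else A k
  | inr s => if s == t.+1 :> nat then onoise e s @^-1` C else A k
  end.

Lemma slice_family t B C A : primitive_family A ->
  primitive_family (slice t B C A).
Proof.
move=> hA [[i|[i s]]|s] /=; rewrite /slice /=.
- exact: (hA (inl (inl i))).
- case: ifP => _; last exact: (hA (inl (inr (i, s)))).
  by exists (B i) => //; rewrite setTI.
- case: ifP => _; last exact: (hA (inr s)).
  by exists C => //; rewrite setTI.
Qed.

Lemma slice_notin t B C A : (forall k, ~~ fresh t.+1 k -> A k = setT) ->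
  forall k, ~~ fresh t k -> slice t B C A k = setT.
Proof.
move=> hA [[i|[i s]]|s] /=; rewrite /slice /= => hk.
- exact: hA.
- move: hk; rewrite -ltnNge => hk; rewrite ltn_eqF// hA//= -ltnNge.
  exact: ltn_trans hk _.
- move: hk; rewrite -leqNgt => hk; rewrite ltn_eqF ?ltnS// hA//= -leqNgt.
  exact: leq_trans hk _.
Qed.

Lemma prod_slice t B C A : (t.+1 < T)%N ->
    (forall k, ~~ fresh t.+1 k -> A k = setT) ->
  \prod_k prob P (slice t B C A k) =
  (\prod_i prob P (wnoise e i t @^-1` B i)) * prob P (onoise e t.+1 @^-1` C) *
  \prod_k prob P (A k).
Proof.
move=> tT hA; have tT' := ltnW tT.
(* c carries the factors at the replaced events, where A is the sure event. *)
pose c (k : source) := match k with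
  | inl (inl _) => 1
  | inl (inr it) => if it.2 == Ordinal tT' then
      prob P (wnoise e it.1 t @^-1` B it.1) else 1
  | inr s => if s == Ordinal tT then prob P (onoise e t.+1 @^-1` C) else 1
  end.
transitivity (\prod_k (c k * prob P (A k))).
  apply: eq_bigr => -[[i|[i s]]|s] _; rewrite /slice /c ?mul1r//=.
    rewrite -val_eqE /=; case: eqP => [st|_]; last by rewrite mul1r.
    by rewrite hA/= -?ltnNge ?st// prob_setT mulr1.
  rewrite -val_eqE /=; case: eqP => [st|_]; last by rewrite mul1r.
  by rewrite hA/= -?leqNgt ?st// prob_setT mulr1.
rewrite big_split; congr (_ * _); rewrite !big_sumType /= big1// mul1r.
rewrite -[X in X * _](pair_bigA _ (fun i s => c (inl (inr (i, s))))) /=.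
congr (_ * _).
  by apply: eq_bigr => i _; rewrite -big_mkcond big_pred1_eq.
by rewrite -big_mkcond big_pred1_eq.
Qed.

Lemma bigcap_slice t B C A : (t.+1 < T)%N ->
    (forall k, ~~ fresh t.+1 k -> A k = setT) ->
  \bigcap_k slice t B C A k =
  [set w | (forall i, B i (wnoise e i t w)) /\ C (onoise e t.+1 w)] `&`
  \bigcap_k A k.
Proof.
move=> tT hA; apply/seteqP; split=> w /=.
  move=> h; split; first split.
  - move=> i; have := h (inl (inr (i, Ordinal (ltnW tT)))) I.
    by rewrite /slice/= eqxx.
  - by have := h (inr (Ordinal tT)) I; rewrite /slice/= eqxx.
  move=> k _; have := h k I; case: k => [[i|[i s]]|s]; rewrite /slice//=.
    by case: eqP => // st _; rewrite hA//= -ltnNge st.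
  by case: eqP => // st _; rewrite hA//= -leqNgt st.
move=> [[hB hC] h] [[i|[i s]]|s] _; rewrite /slice/=.
- exact: h.
- by case: eqP => [->|_]; [exact: hB|exact: h].
- by case: eqP => [->|_]; [exact: hC|exact: h].
Qed.

Lemma whole_family : primitive_family (fun=> setT).
Proof. by move=> [[i|[i s]]|s]; exists setT => //; rewrite setTI preimage_setT. Qed.

(** Given the current state and the prescription, the subsystems move
    independently of each other. *)
Lemma next_state_probE t x gamma x' : (t.+1 < T)%N ->
  next_state_prob t x gamma x' =
  \prod_i prob P (wnoise e i t @^-1`
    [set v | dyn S t (x i) (gamma (x i)) v (emp x) = x' i]).
Proof.
move=> tT; pose B i := [set v | dyn S t (x i) (gamma (x i)) v (emp x) = x' i].
have := prob_cylinder (slice_family t B setT whole_family).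
rewrite prod_slice// preimage_setT prob_setT mulr1 big1_eq mulr1.
move=> <-; rewrite bigcap_slice//; congr prob; apply/seteqP; split=> w /=.
  by move=> xx'; split => //; split=> // i; rewrite /B /= -xx' ffunE.
by move=> [[h _] _]; apply/ffunP => i; rewrite ffunE; exact: h.
Qed.

Lemma measurable_next_state t x gamma x' : (t < T)%N ->
  measurable [set w | next_state t x gamma w = x'].
Proof.
move=> tT; rewrite [X in measurable X](_ : _ = \bigcap_(i : 'I_n)
    (wnoise e i t @^-1` [set v | dyn S t (x i) (gamma (x i)) v (emp x) = x' i])).
  by apply: fin_bigcap_measurable => // i _; exact: measurable_wnoise.
apply/seteqP; split=> w /= h => [i _|]; first by rewrite -h ffunE.
by apply/ffunP => i; rewrite ffunE; exact: h.
Qed.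

Lemma traj0E psi x y : [set w | traj S e psi 0 w = (x, [tuple y])] =
  [set w | (forall i, init e i w = x i) /\ obs S 0 (emp x) (onoise e 0 w) = y].
Proof.
apply/seteqP; split=> w /=.
  move=> [h]; rewrite h => ->; split=> // i.
  by rewrite -h ffunE.
move=> [h hy]; have -> : [ffun i => init e i w] = x.
  by apply/ffunP => i; rewrite ffunE.
by rewrite hy.
Qed.

(** The counterpart of [slice] for the variables that determine the initial state
    and the first observation. *)
Definition start (x : {ffun 'I_n -> X}) (C : set N) A (k : source) : set Omega :=
  match k with
  | inl (inl i) => init e i @^-1` [set x i]
  | inl (inr _) => A k
  | inr s => if s == 0 :> nat then onoise e s @^-1` C else A k
  end.

Lemma start_family x C A : primitive_family A -> primitive_family (start x C A).
Proof.
move=> hA [[i|[i s]]|s] /=; rewrite /start /=.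
- by exists [set x i] => //; rewrite setTI.
- exact: (hA (inl (inr (i, s)))).
- case: ifP => _; last exact: (hA (inr s)).
  by exists C => //; rewrite setTI.
Qed.

Lemma prod_start x C A : (0 < T)%N ->
    (forall k, ~~ fresh 0 k -> A k = setT) ->
  \prod_k prob P (start x C A k) =
  (\prod_i prob P (init e i @^-1` [set x i])) * prob P (onoise e 0 @^-1` C) *
  \prod_k prob P (A k).
Proof.
move=> T0 hA.
pose c (k : source) := match k with
  | inl (inl i) => prob P (init e i @^-1` [set x i])
  | inl (inr it) => 1
  | inr s => if s == Ordinal T0 then prob P (onoise e 0 @^-1` C) else 1
  end.
transitivity (\prod_k (c k * prob P (A k))).
  apply: eq_bigr => -[[i|[i s]]|s] _; rewrite /start /c ?mul1r//=.
    by rewrite hA// prob_setT mulr1.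
  rewrite -val_eqE /=; case: eqP => [st|_]; last by rewrite mul1r.
  by rewrite hA/= -?leqNgt ?st// prob_setT mulr1.
rewrite big_split; congr (_ * _); rewrite !big_sumType /=.
rewrite [X in _ * X * _]big1// mulr1; congr (_ * _).
by rewrite -big_mkcond big_pred1_eq.
Qed.

Lemma bigcap_start x C A : (0 < T)%N ->
    (forall k, ~~ fresh 0 k -> A k = setT) ->
  \bigcap_k start x C A k =
  [set w | (forall i, init e i w = x i) /\ C (onoise e 0 w)] `&` \bigcap_k A k.
Proof.
move=> T0 hA; apply/seteqP; split=> w /=.
  move=> h; split; first split.
  - by move=> i; have := h (inl (inl i)) I.
  - by have := h (inr (Ordinal T0)) I.
  move=> k _; have := h k I; case: k => [[i|[i s]]|s]; rewrite /start//=.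
    by rewrite hA.
  by case: eqP => // st _; rewrite hA//= -leqNgt st.
move=> [[hB hC] h] [[i|[i s]]|s] _; rewrite /start/=.
- exact: hB.
- exact: h.
- by case: eqP => [->|_]; [exact: hC|exact: h].
Qed.

(** Measurability is carried along because the induction step sums over the
    previous state, and additivity needs measurable events. *)
Definition independent_of_fresh psi t : Prop := forall v A,
    primitive_family A -> (forall k, ~~ fresh t k -> A k = setT) ->
  measurable [set w | traj S e psi t w = v] /\
  prob P ([set w | traj S e psi t w = v] `&` \bigcap_k A k) =
  prob P [set w | traj S e psi t w = v] * \prod_k prob P (A k).

Lemma traj0_cylinder psi x y A : (0 < T)%N ->
    primitive_family A -> (forall k, ~~ fresh 0 k -> A k = setT) ->
  let E := [set w | traj S e psi 0 w = (x, [tuple y])] `&` \bigcap_k A k in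
  measurable E /\
  prob P E = (\prod_i prob P (init e i @^-1` [set x i])) *
    obs_prob S P e 0 y (emp x) * \prod_k prob P (A k).
Proof.
move=> T0 hA fA; set E := (X in let E := X in _) => /=.
have -> : E = \bigcap_k start x [set nu | obs S 0 (emp x) nu = y] A k.
  by rewrite bigcap_start// /E traj0E.
have hA' := start_family x [set nu | obs S 0 (emp x) nu = y] hA.
by split; [exact: measurable_cylinder|rewrite prob_cylinder// prod_start].
Qed.

(** Conditioning on the previous state x makes the event a product: the
    trajectory at index t, the noises of the step, and the fresh events of A.
    Independence at index t then factors it. *)
Lemma trajS_cylinder psi t x' (ys : t.+1.-tuple Y) y A : (t.+1 < T)%N ->
    independent_of_fresh psi t ->
    primitive_family A -> (forall k, ~~ fresh t.+1 k -> A k = setT) ->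
  let E := [set w | traj S e psi t.+1 w = (x', [tuple of rcons ys y])] `&`
    \bigcap_k A k in
  measurable E /\
  prob P E = (\sum_x prob P [set w | traj S e psi t w = (x, ys)] *
      next_state_prob t x (psi t ys) x') *
    obs_prob S P e t.+1 y (emp x') * \prod_k prob P (A k).
Proof.
move=> tT IH hA fA; set E := (X in let E := X in _) => /=.
pose B (x : {ffun 'I_n -> X}) i :=
  [set v | dyn S t (x i) (psi t ys (x i)) v (emp x) = x' i].
pose C := [set nu | obs S t.+1 (emp x') nu = y].
have fiberE x : E `&` [set w | state S e psi t w = x] =
    [set w | traj S e psi t w = (x, ys)] `&` \bigcap_k slice t (B x) C A k.
  rewrite bigcap_slice//; apply/seteqP; split=> w /=.
    move=> [[Ew Aw] xw].
    have [tw xw' yw] := (traj_stepP _ _ _ _ _ _).1 (conj Ew xw).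
    by split=> //; split=> //; split=> // i; rewrite /B/= -xw' ffunE.
  move=> [tw [[Bw Cw] Aw]].
  have xw' : next_state t x (psi t ys) w = x'.
    by apply/ffunP => i; rewrite ffunE; exact: Bw.
  by have [] := (traj_stepP psi x ys x' y w).2 (And3 tw xw' Cw).
have mE x : measurable (E `&` [set w | state S e psi t w = x]).
  rewrite fiberE; apply: measurableI.
    by have [] := IH (x, ys) _ whole_family (fun _ _ => erefl).
  exact/measurable_cylinder/slice_family.
split; first exact: measurable_finite_partition mE.
rewrite (prob_finite_partition P mE) !mulr_suml; apply: eq_bigr => x _.
rewrite fiberE (IH _ _ (slice_family _ _ _ hA) (slice_notin _ _ fA)).2.
by rewrite prod_slice// next_state_probE// !mulrA.
Qed.

Lemma traj_independent psi t : (t < T)%N -> independent_of_fresh psi t.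
Proof.
(* It suffices that the probability is proportional to the product of the
   probabilities of A: the sure family identifies the constant. *)
have factor s v : (exists c, forall A, primitive_family A ->
      (forall k, ~~ fresh s k -> A k = setT) ->
    let E := [set w | traj S e psi s w = v] `&` \bigcap_k A k in
    measurable E /\ prob P E = c * \prod_k prob P (A k)) ->
  forall A, primitive_family A -> (forall k, ~~ fresh s k -> A k = setT) ->
    measurable [set w | traj S e psi s w = v] /\
    prob P ([set w | traj S e psi s w = v] `&` \bigcap_k A k) =
    prob P [set w | traj S e psi s w = v] * \prod_k prob P (A k).
  move=> [c /= cE] A hA fA.
  have [] := cE _ whole_family (fun _ _ => erefl).
  rewrite bigcapT// setIT => mE ->; split=> //.
  by rewrite (cE A hA fA).2 prob_setT big1_eq mulr1.
elim: t => [|t IH] tT [x ys]; apply: factor.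
  case/tupleP: ys => y ys; rewrite [ys]tuple0; eexists => A hA fA.
  exact: traj0_cylinder.
have [ys' [y ->]] := tuple_rcons ys; eexists => A hA fA.
by apply: trajS_cylinder => //; apply: IH; exact: ltnW.
Qed.

Lemma measurable_traj psi t v : (t < T)%N ->
  measurable [set w | traj S e psi t w = v].
Proof.
move=> tT.
by have [] := traj_independent psi tT v whole_family (fun _ _ => erefl).
Qed.

Lemma prob_traj0 psi x y : (0 < T)%N ->
  prob P [set w | traj S e psi 0 w = (x, [tuple y])] =
  (\prod_i prob P (init e i @^-1` [set x i])) * obs_prob S P e 0 y (emp x).
Proof.
move=> T0.
have [_] := traj0_cylinder psi x y T0 whole_family (fun _ _ => erefl).
by rewrite bigcapT// setIT => ->; rewrite prob_setT big1_eq mulr1.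
Qed.

Lemma prob_trajS psi t x' (ys : t.+1.-tuple Y) y : (t.+1 < T)%N ->
  prob P [set w | traj S e psi t.+1 w = (x', [tuple of rcons ys y])] =
  (\sum_x prob P [set w | traj S e psi t w = (x, ys)] *
     next_state_prob t x (psi t ys) x') * obs_prob S P e t.+1 y (emp x').
Proof.
move=> tT; have [_] := trajS_cylinder x' ys y tT
  (traj_independent psi (ltnW tT)) whole_family (fun _ _ => erefl).
by rewrite bigcapT// setIT => ->; rewrite prob_setT big1_eq mulr1.
Qed.

End Independence.
End Model.

(** * Permutations of the subsystems *)

Section Permutations.
Context {n : nat} {X : finType}.
Implicit Types (x : {ffun 'I_n -> X}) (sigma : {perm 'I_n}).

Definition permute sigma x : {ffun 'I_n -> X} := [ffun i => x (sigma i)].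

Lemma permute_inj sigma : injective (permute sigma).
Proof.
move=> x x' /ffunP xx'; apply/ffunP => i; have := xx' ((sigma^-1)%g i).
by rewrite !ffunE permKV.
Qed.

Lemma emp_permute sigma x : emp (permute sigma x) = emp x.
Proof.
apply/val_inj/ffunP => a; apply/val_inj; rewrite /= !emp_countsE -!sum1_card.
rewrite [RHS](reindex_inj (@perm_inj _ sigma)) /=.
by apply: eq_bigl => i; rewrite !inE ffunE.
Qed.

(** The mean-field is a complete invariant of the joint state up to permutation:
    the two lists of states have equal multiplicities. *)
Lemma emp_eq_permute x x' : emp x = emp x' -> exists sigma, x' = permute sigma x.
Proof.
move=> xx'; have /tuple_permP[sigma sE] : perm_eq (mktuple x') (mktuple x).
  have cE (y : {ffun 'I_n -> X}) a : count_mem a (mktuple y) = emp_counts y a.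
    by rewrite emp_countsE -sum1_count !big_map -sum1_card.
  apply/allP => a _; apply/eqP; rewrite [LHS]cE [RHS]cE.
  exact: (congr1 (fun z : meanfield n X => nat_of_ord (val z a)) (esym xx')).
exists sigma; apply/ffunP => i; rewrite ffunE.
have /(congr1 (fun t : n.-tuple X => tnth t i)) := val_inj sE.
by rewrite !tnth_mktuple.
Qed.
End Permutations.

(** * Mass and normalisation *)

Section Normalise.
Context {R : realType} {I : finType}.
Implicit Types b : {ffun I -> R}.

Definition mass b : R := \sum_i b i.

(** For b of zero mass this is 0, division by 0 being 0. *)
Definition normalise b : {ffun I -> R} := [ffun i => b i / mass b].

Lemma normaliseK b i : mass b != 0 -> mass b * normalise b i = b i.
Proof. by move=> b0; rewrite ffunE mulrC divfK. Qed.

Lemma normalise_scale b (c : R) : c != 0 ->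
  normalise [ffun i => c * b i] = normalise b.
Proof.
move=> c0; apply/ffunP => i; rewrite !ffunE /mass.
under eq_bigr do rewrite ffunE.
by rewrite -mulr_sumr invfM mulrACA divff// mul1r.
Qed.

Lemma mass_ge0 b : (forall i, 0 <= b i) -> 0 <= mass b.
Proof. by move=> b0; apply: sumr_ge0. Qed.

Lemma mass_eq0 b : (forall i, 0 <= b i) -> mass b = 0 -> b = [ffun=> 0].
Proof.
move=> b0 /eqP; rewrite psumr_eq0// => /allP h; apply/ffunP => i; rewrite ffunE.
by apply/eqP/h; rewrite mem_index_enum.
Qed.
End Normalise.

(** * Exchangeability and the recursion for the belief *)

Section Exchangeability.
Context {R : realType} {d : measure_display} {Omega : measurableType d}.
Context {X U : finType} {W : countType} {N : finType} {Y : choiceType} {n : nat}.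
Variables (P : probability Omega R) (S : system R X U W N Y n).
Variable e : primitives Omega X W N n.
Context {T : nat} {PX : X -> R} {PW : nat -> W -> R} {PN : nat -> N -> R}.
Hypothesis He : primitive_assumptions P T e PX PW PN.
Implicit Types (psi : strategy X U Y) (z : meanfield n X).

(** The belief before normalisation, that is the conditional law of the mean-field
    times the probability of the history ys.  Its recursion is linear and holds
    on null histories too. *)
Definition joint psi t (ys : t.+1.-tuple Y) : {ffun meanfield n X -> R} :=
  [ffun z => prob P
    [set w | emp (state S e psi t w) = z /\ history S e psi t w = ys]].

Lemma next_state_prob_permute sigma t x gamma x' : (t.+1 < T)%N ->
  next_state_prob P S e t (permute sigma x) gamma (permute sigma x') =
  next_state_prob P S e t x gamma x'.
Proof.
move=> tT; rewrite !(next_state_probE S He)// emp_permute.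
rewrite [RHS](reindex_inj (@perm_inj _ sigma)) /=.
apply: eq_bigr => i _; rewrite !ffunE.
exact: (prob_wnoise_eq He _ _ _ (ltnW tT)).
Qed.

(** By induction along the forward recursion: initial law, transition
    probabilities and observation probabilities are invariant when states are
    permuted simultaneously, and the sum over previous states is reindexed. *)
Lemma prob_traj_permute psi sigma t x (ys : t.+1.-tuple Y) : (t < T)%N ->
  prob P [set w | traj S e psi t w = (permute sigma x, ys)] =
  prob P [set w | traj S e psi t w = (x, ys)].
Proof.
elim: t x ys => [|t IH] x ys tT.
  case/tupleP: ys => y ys; rewrite [ys]tuple0 !(prob_traj0 _ He)// emp_permute.
  rewrite [in RHS](reindex_inj (@perm_inj _ sigma)) /=; congr (_ * _).
  by apply: eq_bigr => i _; rewrite ffunE; exact: (prob_init_eq He).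
have [ys' [y ->]] := tuple_rcons ys; rewrite !(prob_trajS _ He)// emp_permute.
rewrite (reindex_inj (@permute_inj _ _ sigma)) /=; congr (_ * _).
by apply: eq_bigr => x0 _; rewrite IH ?next_state_prob_permute// ltnW.
Qed.

Let joint_split psi t (ys : t.+1.-tuple Y) x :
  [set w | history S e psi t w = ys] `&` [set w | state S e psi t w = x] =
  [set w | traj S e psi t w = (x, ys)].
Proof.
apply/seteqP; split=> w; rewrite /state /history /=.
  by case: (traj _ _ _ _ _) => x0 ys0 /= [-> ->].
by move=> ->.
Qed.

Let joint_image psi t (ys : t.+1.-tuple Y) z : (t < T)%N ->
  measurable [set w | emp (state S e psi t w) = z /\ history S e psi t w = ys] /\
  prob P [set w | emp (state S e psi t w) = z /\ history S e psi t w = ys] =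
  \sum_(x | emp x == z) prob P [set w | traj S e psi t w = (x, ys)].
Proof.
move=> tT; have [] := @prob_finite_image _ _ _ P _ _ (state S e psi t) (@emp n X) z
    [set w | history S e psi t w = ys]; last first.
  by move=> mE ->; split=> //; under eq_bigr do rewrite joint_split.
by move=> x; rewrite joint_split; exact: (measurable_traj _ He).
Qed.

Lemma jointE psi t ys z : (t < T)%N ->
  joint psi ys z = \sum_(x in fiber z) prob P [set w | traj S e psi t w = (x, ys)].
Proof.
move=> tT; rewrite ffunE (joint_image _ _ _ tT).2.
by apply: eq_bigl => x; rewrite inE.
Qed.

Lemma prob_history psi t (ys : t.+1.-tuple Y) : (t < T)%N ->
  prob P [set w | history S e psi t w = ys] = mass (joint psi ys).
Proof.
move=> tT.
have zE z : [set w | history S e psi t w = ys] `&`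
    [set w | emp (state S e psi t w) = z] =
    [set w | emp (state S e psi t w) = z /\ history S e psi t w = ys].
  by rewrite setIC.
rewrite (@prob_finite_partition _ _ _ _ _ (fun w => emp (state S e psi t w))).
  by apply: eq_bigr => z _; rewrite zE ffunE.
by move=> z; rewrite zE; exact: (joint_image _ _ _ tT).1.
Qed.

Lemma prob_traj_uniform psi t x (ys : t.+1.-tuple Y) : (t < T)%N ->
  prob P [set w | traj S e psi t w = (x, ys)] =
  #|fiber (emp x)|%:R^-1 * joint psi ys (emp x).
Proof.
move=> tT; rewrite jointE//.
rewrite (eq_bigr (fun=> prob P [set w | traj S e psi t w = (x, ys)])).
  rewrite sumr_const -[X in _ * X]mulr_natl mulKf// pnatr_eq0 -lt0n.
  by apply/card_gt0P; exists x; rewrite inE.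
move=> x'; rewrite inE => /eqP/esym/emp_eq_permute[sigma ->].
exact: prob_traj_permute.
Qed.

(** An expectation over joint states only sees the fiber averages of the
    integrand; applied to the cost it gives lhat, to the transition
    probabilities trans. *)
Lemma sum_prob_traj psi t (ys : t.+1.-tuple Y) (g : {ffun 'I_n -> X} -> R) :
    (t < T)%N ->
  \sum_x prob P [set w | traj S e psi t w = (x, ys)] * g x =
  \sum_z (#|fiber z|%:R^-1 * \sum_(x in fiber z) g x) * joint psi ys z.
Proof.
move=> tT; rewrite (partition_big (@emp n X) predT) //=; apply: eq_bigr => z _.
rewrite -mulrA mulrCA mulr_suml; apply: eq_big => [x|x /eqP <-].
  by rewrite inE.
by rewrite prob_traj_uniform// mulrC.
Qed.

Lemma trans_sum t z' z gamma : (t < T)%N ->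
  trans S P e t z' z gamma = #|fiber z|%:R^-1 *
    \sum_(x in fiber z) \sum_(x' in fiber z') next_state_prob P S e t x gamma x'.
Proof.
move=> tT; congr (_ * _); apply: eq_bigr => x; rewrite inE => /eqP <-.
have [] := @prob_finite_image _ _ _ P _ _ (next_state S e t x gamma) (@emp n X) z' setT.
  by move=> x'; rewrite setTI; exact: (measurable_next_state _ He).
rewrite setIT => _ ->; apply: eq_big => [x'|x' _]; first by rewrite inE.
by rewrite setTI.
Qed.

(** The numerator of the Bayes update, linear in b. *)
Definition update t y (b : {ffun meanfield n X -> R}) gamma :
    {ffun meanfield n X -> R} :=
  [ffun z => obs_prob S P e t.+1 y z * predict S P e t z b gamma].

Lemma jointS psi t (ys : t.+1.-tuple Y) y : (t.+1 < T)%N ->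
  joint psi [tuple of rcons ys y] = update t y (joint psi ys) (psi t ys).
Proof.
move=> tT; apply/ffunP => z'; rewrite jointE// ffunE /predict.
rewrite (eq_bigr (fun x' => obs_prob S P e t.+1 y z' * \sum_x prob P
    [set w | traj S e psi t w = (x, ys)] * next_state_prob P S e t x (psi t ys) x')).
  rewrite -mulr_sumr exchange_big/=; congr (_ * _).
  under [RHS]eq_bigr do rewrite trans_sum ?(ltnW tT)//.
  rewrite -sum_prob_traj ?(ltnW tT)//.
  by apply: eq_bigr => x _; rewrite mulr_sumr.
by move=> x'; rewrite inE => /eqP <-; rewrite (prob_trajS _ He)// mulrC.
Qed.
End Exchangeability.

(** * The dynamic program on unnormalised beliefs *)

Section DynamicProgram.
Context {R : realType} {d : measure_display} {Omega : measurableType d}.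
Context {X U : finType} {W : countType} {N : finType} {Y : choiceType} {n : nat}.
Variables (P : probability Omega R) (S : system R X U W N Y n).
Variables (e : primitives Omega X W N n) (u0 : U).
Implicit Types (b : {ffun meanfield n X -> R}) (gamma : {ffun X -> U}).

Lemma min_prescription_le (g : {ffun X -> U} -> R) gamma :
  min_prescription u0 g <= g gamma.
Proof. exact: bigmin_le. Qed.

(** The iterated minimum starts from a value of g, so it is itself a value. *)
Lemma min_prescription_attained (g : {ffun X -> U} -> R) :
  exists gamma, g gamma = min_prescription u0 g.
Proof.
rewrite /min_prescription; elim/big_ind: _ => [|x y [g1 <-] [g2 <-]|g1 _].
- by exists [ffun=> u0].
- by rewrite /Num.min; case: ifP => _; [exists g1|exists g2].
- by exists g1.
Qed.

Lemma simplex_normalise b : (forall z, 0 <= b z) -> 0 < mass b ->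
  simplex (normalise b).
Proof.
move=> b0 m0; split=> [z|]; first by rewrite ffunE divr_ge0// ltW.
under eq_bigr do rewrite ffunE.
by rewrite -mulr_suml divff// gt_eqF.
Qed.

Lemma update_scale t y (c : R) b gamma :
  update P S e t y [ffun z => c * b z] gamma =
  [ffun z => c * update P S e t y b gamma z].
Proof.
apply/ffunP => z; rewrite !ffunE /predict mulrCA; congr (_ * _).
by rewrite mulr_sumr; apply: eq_bigr => z' _; rewrite ffunE mulrCA.
Qed.

Lemma next_beliefE t y b gamma :
  next_belief S P e t y b gamma = normalise (update P S e t y b gamma).
Proof.
apply/ffunP => z; rewrite !ffunE; congr (_ / _).
by apply: eq_bigr => z' _; rewrite ffunE.
Qed.

Lemma next_obs_probE t y b gamma :
  next_obs_prob S P e t y b gamma = mass (update P S e t y b gamma).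
Proof. by apply: eq_bigr => z' _; rewrite ffunE. Qed.

Lemma mass_update_eq0 t y b gamma : (forall z, 0 <= b z) -> mass b = 0 ->
  mass (update P S e t y b gamma) = 0.
Proof.
move=> b_ge0 /(mass_eq0 b_ge0) ->; rewrite [LHS]big1// => z _.
by rewrite ffunE /predict big1 ?mulr0// => z' _; rewrite ffunE mulr0.
Qed.

(** The Bayes filter does not see the scale of the belief, so normalisation can be
    postponed. *)
Lemma normalise_update t y b gamma : mass b != 0 ->
  normalise (update P S e t y (normalise b) gamma) =
  normalise (update P S e t y b gamma).
Proof.
move=> b0; rewrite -[RHS](normalise_scale _ (invr_neq0 b0)) -update_scale.
by congr (normalise (update _ _ _ _ _ _ _)); apply/ffunP => z; rewrite !ffunE mulrC.
Qed.

Lemma obs_prob_notin t y z : y \notin obs_values S t -> obs_prob S P e t y z = 0.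
Proof.
move=> hy; rewrite /obs_prob (_ : [set w | _] = set0) ?prob_set0//.
apply/seteqP; split=> // w /= wy; move: hy.
by rewrite -wy obs_valuesP.
Qed.

Lemma cond_exp_nextE t v b gamma :
  cond_exp_next S P e t v b gamma =
  \sum_(y <- obs_values S t.+1) mass (update P S e t y b gamma) *
    v (normalise (update P S e t y b gamma)).
Proof.
rewrite /cond_exp_next -(fsbig_widen [set` obs_values S t.+1])//=.
  rewrite -fsbig_seq ?undup_uniq//.
  by apply: eq_bigr => y _; rewrite next_obs_probE next_beliefE.
move=> y [_ /negP hy] /=; rewrite next_obs_probE /mass big1 ?mul0r// => z _.
by rewrite ffunE obs_prob_notin ?mul0r.
Qed.

(** The Bellman right-hand side multiplied by the mass of the belief.  Both of its
    terms are homogeneous in b, so histories of zero probability need no special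
    treatment when it is summed over histories. *)
Definition scaled_bellman t v b gamma : R :=
  \sum_z lhat S t z gamma * b z +
  \sum_(y <- obs_values S t.+1) mass (update P S e t y b gamma) *
    v (normalise (update P S e t y b gamma)).

Lemma scaled_bellmanE t v b gamma : (forall z, 0 <= b z) ->
  mass b * bellman_rhs S P e t v (normalise b) gamma = scaled_bellman t v b gamma.
Proof.
move=> b_ge0; rewrite /scaled_bellman; have [b0|b0] := eqVneq (mass b) 0.
  rewrite b0 mul0r big1 => [|z _]; last by rewrite (mass_eq0 b_ge0 b0) ffunE mulr0.
  by rewrite big1 ?addr0// => y _; rewrite mass_update_eq0 ?mul0r.
rewrite /bellman_rhs cond_exp_nextE mulrDr /ltilde !mulr_sumr; congr (_ + _).
  by apply: eq_bigr => z _; rewrite mulrCA normaliseK.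
apply: eq_bigr => y _; rewrite normalise_update// mulrA; congr (_ * _).
rewrite /mass mulr_sumr; apply: eq_bigr => z _.
rewrite -/(mass b) -[LHS](ffunE (fun z => mass b * update _ _ _ _ _ _ _ z)).
rewrite -update_scale; congr (update _ _ _ _ _ _ _ _).
by apply/ffunP => z'; rewrite ffunE normaliseK.
Qed.

Variable T : nat.

Lemma scaled_value_le t b gamma : (t < T)%N -> (forall z, 0 <= b z) ->
  mass b * value S T P e u0 t (normalise b) <=
  scaled_bellman t (value S T P e u0 t.+1) b gamma.
Proof.
move=> tT b0; rewrite -scaled_bellmanE// value_rec//.
by rewrite ler_wpM2l ?mass_ge0// min_prescription_le.
Qed.

Lemma scaled_value_eq t b gamma (phi : belief_law R n X U) : (t < T)%N ->
    (forall z, 0 <= b z) -> dp_minimizer S T P e u0 phi ->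
    (0 < mass b -> gamma = phi t (normalise b)) ->
  mass b * value S T P e u0 t (normalise b) =
  scaled_bellman t (value S T P e u0 t.+1) b gamma.
Proof.
move=> tT b0 hphi hgamma; rewrite -scaled_bellmanE//.
have := mass_ge0 b0; rewrite le_eqVlt => /predU1P[<-|m0]; first by rewrite !mul0r.
by rewrite hgamma// hphi//; exact: simplex_normalise.
Qed.

Lemma dp_minimizer_exists : exists phi, dp_minimizer S T P e u0 phi.
Proof.
pose g t pi := bellman_rhs S P e t (value S T P e u0 t.+1) pi.
exists (fun t pi => sval (cid (min_prescription_attained (g t pi)))).
move=> t tT pi _; rewrite value_rec//.
exact: (svalP (cid (min_prescription_attained (g t pi)))).
Qed.

End DynamicProgram.

(** * Expected costs and the telescoping argument *)

Section Optimality.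
Context {R : realType} {d : measure_display} {Omega : measurableType d}.
Context {X U : finType} {W : countType} {N : finType} {Y : choiceType} {n : nat}.
Variables (P : probability Omega R) (S : system R X U W N Y n).
Variables (e : primitives Omega X W N n) (u0 : U).
Context {T : nat} {PX : X -> R} {PW : nat -> W -> R} {PN : nat -> N -> R}.
Hypothesis He : primitive_assumptions P T e PX PW PN.
Implicit Types (psi : strategy X U Y) (phi : belief_law R n X U).

Lemma joint_ge0 psi t (ys : t.+1.-tuple Y) z : 0 <= joint P S e psi ys z.
Proof. by rewrite ffunE prob_ge0. Qed.

Lemma prob_info psi t w : (t < T)%N ->
  prob P (info S e psi t w) = mass (joint P S e psi (history S e psi t w)).
Proof. by move=> tT; rewrite infoE (prob_history _ He). Qed.

Lemma beliefE psi t w : (t < T)%N ->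
  belief S P e psi t w = normalise (joint P S e psi (history S e psi t w)).
Proof.
move=> tT; apply/ffunP => z; rewrite !ffunE /cond_prob prob_info// infoE.
by congr (prob P _ / _); apply/seteqP; split.
Qed.

(** Implementing a belief-based law is a condition on the observation histories of
    positive probability only. *)
Lemma implementsP phi psi : implements S T P e phi psi <->
  forall t (ys : t.+1.-tuple Y), (t < T)%N -> 0 < mass (joint P S e psi ys) ->
    psi t ys = phi t (normalise (joint P S e psi ys)).
Proof.
split=> [h t ys tT m0|h t tT w].
  have [w wys] : exists w, history S e psi t w = ys.
    apply: contrapT => nys; move: m0.
    rewrite -(prob_history _ He)// (_ : [set w | _] = set0) ?prob_set0 ?ltxx//.
    by apply/seteqP; split=> // w /= wys; apply: nys; exists w.
  by have := h t tT w; rewrite beliefE// prob_info// /prescription wys; exact.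
by rewrite prob_info// beliefE//; exact: h.
Qed.

Definition stage_cost psi t : R :=
  \sum_(ys <- histories S t) \sum_z lhat S t z (psi t ys) * joint P S e psi ys z.

Lemma expected_stage_cost psi t : (t < T)%N ->
  let c w := (gcost S t (state S e psi t w) (prescription S e psi t w))%:E in
  P.-integrable setT c /\ (\int[P]_w c w = (stage_cost psi t)%:E)%E.
Proof.
move=> tT.
pose s := [seq (x, ys) | x <- enum {ffun 'I_n -> X}, ys <- histories S t].
pose g (v : {ffun 'I_n -> X} * t.+1.-tuple Y) := gcost S t v.1 (psi t v.2).
have := @expectation_discrete _ _ _ P _ (traj S e psi t) s g.
have us : uniq s.
  by apply: allpairs_uniq; [exact: enum_uniq|exact: histories_uniq|move=> [? ?] []].
have ws w : traj S e psi t w \in s.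
  apply/allpairsP; exists (traj S e psi t w).
  by rewrite mem_enum (mem_histories _ e psi); case: (traj _ _ _ _ _).
move=> /(_ us ws (fun v _ => measurable_traj _ He _ _ tT)) [ig Eg] /=; split=> //.
rewrite Eg /s big_allpairs exchange_big/=; congr EFin; apply: eq_bigr => ys _.
transitivity (\sum_x prob P [set w | traj S e psi t w = (x, ys)] *
    gcost S t x (psi t ys)).
  by rewrite big_enum/=; apply: eq_bigr => x _; rewrite mulrC.
by rewrite (sum_prob_traj _ He).
Qed.

Lemma total_costE psi : total_cost S T P e psi = (\sum_(t < T) stage_cost psi t)%:E.
Proof.
rewrite /total_cost unlock.
under eq_integral do rewrite -sumEFin.
rewrite integral_sum//; last first.
  by move=> t; exact: (expected_stage_cost psi (ltn_ord t)).1.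
rewrite -sumEFin; apply: eq_bigr => t _.
exact: (expected_stage_cost psi (ltn_ord t)).2.
Qed.

(** The expectation of V_t(Pi_t) under psi: the mass of the unnormalised belief is
    the probability of the history. *)
Definition value_sum psi t : R :=
  \sum_(ys <- histories S t) mass (joint P S e psi ys) *
    value S T P e u0 t (normalise (joint P S e psi ys)).

(** The first observation precedes every prescription. *)
Lemma value_sum0 psi psi' : value_sum psi 0 = value_sum psi' 0.
Proof. by []. Qed.

Lemma value_sumT psi : value_sum psi T = 0.
Proof. by rewrite /value_sum big1// => ys _; rewrite value_end mulr0. Qed.

Lemma sum_scaled_bellman psi t : (t < T)%N ->
  \sum_(ys <- histories S t) scaled_bellman P S e t (value S T P e u0 t.+1)
    (joint P S e psi ys) (psi t ys) = stage_cost psi t + value_sum psi t.+1.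
Proof.
move=> tT; rewrite big_split/=; congr (_ + _).
(* At the last stage there is no next observation, but the next value is 0. *)
have [tT'|] := ltnP t.+1 T.
  rewrite /value_sum /= big_allpairs_dep/=.
  by apply: eq_bigr => ys _; apply: eq_bigr => y _; rewrite (jointS _ He).
rewrite -subn_eq0 => /eqP Tt; rewrite /value_sum /value Tt /=.
rewrite !big1// => ys _; rewrite ?mulr0// big1// => y _.
by rewrite mulr0.
Qed.

Lemma value_sum_le psi t : (t < T)%N ->
  value_sum psi t <= stage_cost psi t + value_sum psi t.+1.
Proof.
move=> tT; rewrite -sum_scaled_bellman//; apply: ler_sum => ys _.
by apply: scaled_value_le => // z; exact: joint_ge0.
Qed.

Lemma value_sum_eq phi psi t : dp_minimizer S T P e u0 phi ->
    implements S T P e phi psi -> (t < T)%N ->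
  value_sum psi t = stage_cost psi t + value_sum psi t.+1.
Proof.
move=> hphi /implementsP hpsi tT; rewrite -sum_scaled_bellman//.
apply: eq_bigr => ys _; apply: (scaled_value_eq tT _ hphi) => [z|m0].
  exact: joint_ge0.
exact: hpsi.
Qed.

Lemma total_cost_ge psi : ((value_sum psi 0)%:E <= total_cost S T P e psi)%E.
Proof.
rewrite total_costE lee_fin.
suff h k : (k <= T)%N ->
    value_sum psi 0 <= \sum_(t < k) stage_cost psi t + value_sum psi k
  by have := h T (leqnn T); rewrite value_sumT addr0.
elim: k => [|k IH] kT; first by rewrite big_ord0 add0r.
rewrite (le_trans (IH (ltnW kT)))// big_ord_recr/= -addrA lerD2l.
exact: value_sum_le.
Qed.

Lemma total_cost_optimal phi psi : dp_minimizer S T P e u0 phi ->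
  implements S T P e phi psi -> total_cost S T P e psi = (value_sum psi 0)%:E.
Proof.
move=> hphi hpsi; rewrite total_costE; congr EFin.
suff h k : (k <= T)%N ->
    \sum_(t < k) stage_cost psi t + value_sum psi k = value_sum psi 0
  by have := h T (leqnn T); rewrite value_sumT addr0.
elim: k => [|k IH] kT; first by rewrite big_ord0 add0r.
rewrite -(IH (ltnW kT)) big_ord_recr/= -addrA; congr (_ + _).
by rewrite (value_sum_eq hphi hpsi kT).
Qed.

(** * The belief filter *)

(* The strategy is arbitrary: the first observation does not depend on it. *)
Definition initial_belief y : {ffun meanfield n X -> R} :=
  normalise (joint P S e (fun _ _ => [ffun=> u0]) [tuple y]).

(** The accumulator carries the time index together with the belief, since the
    filter is not homogeneous in time. *)
Definition filter_step phi (p : nat * {ffun meanfield n X -> R}) y :=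
  (p.1.+1, next_belief S P e p.1 y p.2 (phi p.1 p.2)).

(** The first observation initialises the filter; the value on the empty sequence
    is a dummy, histories being nonempty. *)
Definition filter_fold phi (ys : seq Y) : nat * {ffun meanfield n X -> R} :=
  if ys is y :: ys' then foldl (filter_step phi) (0%N, initial_belief y) ys'
  else (0%N, [ffun=> 0]).

Definition filtered phi ys := (filter_fold phi ys).2.

Definition filter_strategy phi : strategy X U Y :=
  fun t ys => phi t (filtered phi ys).

Lemma filter_fold_index phi t (ys : t.+1.-tuple Y) : (filter_fold phi ys).1 = t.
Proof.
elim: t ys => [|t IH] ys; first by case/tupleP: ys => y ys; rewrite [ys]tuple0.
have [ys' [y ->]] := tuple_rcons ys; case/tupleP: ys' (IH ys') => y0 ys' /=.
by rewrite foldl_rcons => /= ->.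
Qed.

Lemma filtered_rcons phi t (ys : t.+1.-tuple Y) y :
  filtered phi (rcons ys y) =
  next_belief S P e t y (filtered phi ys) (phi t (filtered phi ys)).
Proof.
have := filter_fold_index phi ys; rewrite /filtered; case/tupleP: ys => y0 ys /=.
by rewrite foldl_rcons /= => ->.
Qed.

(** The filter uses the prescriptions phi(belief), which under [filter_strategy]
    are the ones applied; so it computes the true belief along every history of
    positive probability.  Prefixes of such a history have positive probability
    as well. *)
Lemma filteredE phi t (ys : t.+1.-tuple Y) : (t < T)%N ->
    0 < mass (joint P S e (filter_strategy phi) ys) ->
  filtered phi ys = normalise (joint P S e (filter_strategy phi) ys).
Proof.
elim: t ys => [|t IH] ys tT.
  by case/tupleP: ys => y ys; rewrite [ys]tuple0.
have [ys' [y ->]] := tuple_rcons ys; rewrite (jointS _ He)// => m0.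
set b := joint _ _ _ _ _ in m0 *.
have b_gt0 : 0 < mass b.
  have b_ge0 z : 0 <= b z by exact: joint_ge0.
  rewrite lt_def mass_ge0// andbT; apply: contraTneq m0 => b0.
  by rewrite mass_update_eq0// ltxx.
rewrite filtered_rcons /filter_strategy IH ?(ltnW tT)//.
by rewrite next_beliefE normalise_update// gt_eqF.
Qed.

Lemma filter_strategy_implements phi :
  implements S T P e phi (filter_strategy phi).
Proof. by apply/implementsP => t ys tT m0; rewrite -filteredE. Qed.

End Optimality.

Theorem theorem2 (R : realType) (d : measure_display) (Omega : measurableType d)
    (P : probability Omega R)
    (X U : finType) (W : countType) (N : finType) (Y : choiceType)
    (n T : nat) (n_gt0 : (0 < n)%N) (u0 : U)
    (S : system R X U W N Y n) (e : primitives Omega X W N n)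
    (PX : X -> R) (PW : nat -> W -> R) (PN : nat -> N -> R)
    (He : primitive_assumptions P T e PX PW PN) :
  [/\ ereal_inf [set total_cost S T P e psi | psi in [set: strategy X U Y]] =
      ereal_inf [set total_cost S T P e psi | psi in markovian S T P e],
      exists phi : belief_law R n X U, dp_minimizer S T P e u0 phi
    & forall phi : belief_law R n X U, dp_minimizer S T P e u0 phi ->
      (exists psi : strategy X U Y, implements S T P e phi psi) /\
      forall psi_star : strategy X U Y, implements S T P e phi psi_star ->
        forall psi : strategy X U Y,
          (total_cost S T P e psi_star <= total_cost S T P e psi)%E].
Proof.
have optimal phi psi_star psi : dp_minimizer S T P e u0 phi ->
    implements S T P e phi psi_star ->
    (total_cost S T P e psi_star <= total_cost S T P e psi)%E.
  move=> hphi hpsi; rewrite (total_cost_optimal He hphi hpsi).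
  by rewrite (value_sum0 _ _ _ _ psi_star psi) (total_cost_ge _ _ He).
have [phi0 hphi0] := dp_minimizer_exists P S e u0 T.
split; first (apply/le_anti/andP; split).
- by apply: le_ereal_inf_tmp => _ [psi _ <-]; apply: ereal_inf_lbound; exists psi.
- have hpsi0 : implements S T P e phi0 (filter_strategy P S e u0 phi0).
    exact: (filter_strategy_implements He).
  apply: le_ereal_inf_tmp => _ [psi _ <-]; apply: ge_ereal_inf.
  exists (total_cost S T P e (filter_strategy P S e u0 phi0)).
    by exists (filter_strategy P S e u0 phi0) => //; exists phi0.
  exact: optimal hphi0 hpsi0.
- by exists phi0.
- move=> phi hphi; split=> [|psi_star hpsi psi].
    exists (filter_strategy P S e u0 phi).
    exact: (filter_strategy_implements He).
  exact: optimal hphi hpsi.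
Qed.
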